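(* Let $U$ be an $n$-qubit unitary and let $\mathcal{Q}_U=\langle\{P\in\mathcal{P}_n \mid \mathrm{tr}[PU]\neq 0\}\rangle$. Let $W\in\mathcal{G}_n$ be a Clifford unitary and $n_1,n_2,n_3\ge 0$ integers with $n_1+n_2+n_3=n$ such that, up to phase, $$\mathcal{Q}_U=W^\dagger\left(\{\mathrm{I},\mathrm{X},\mathrm{Y},\mathrm{Z}\}^{\otimes n_1}\otimes\{\mathrm{I},\mathrm{Z}\}^{\otimes n_2}\otimes\{\mathrm{I}\}^{\otimes n_3}\right)W .$$ Let $P\in\mathcal{P}_n$, let $\mathcal{E}_P(\cdot)=P\cdot P$ be the corresponding Pauli channel, and write $P=W^\dagger(P_1\otimes P_2\otimes P_3)W$ up to phase, with $P_1\in\mathcal{P}_{n_1}$, $P_2\in\mathcal{P}_{n_2}$, $P_3\in\mathcal{P}_{n_3}$. Then the symmetric Clifford twirling $\mathscr{T}_{\mathcal{Q}_U}(\mathcal{E}_P)=\mathbb{E}_{D\in\mathcal{G}_{n,\mathcal{Q}_U}}[\mathcal{D}^\dagger\circ\mathcal{E}_P\circ\mathcal{D}]$ is given as follows: (i) if $P_2\notin\{\mathrm{I},\mathrm{Z}\}^{\otimes n_2}$, then $$\mathscr{T}_{\mathcal{Q}_U}(\mathcal{E}_P)=\mathbb{E}_{Q_2\in\{\mathrm{I},\mathrm{Z}\}^{\otimes n_2},\;Q_3\in\mathcal{P}_{n_3}}\left[\mathcal{E}_{W^\dagger(P_1\otimes P_2Q_2\otimes Q_3)W}\right];$$ (ii)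 if $P_2\in\{\mathrm{I},\mathrm{Z}\}^{\otimes n_2}$ and $P_3\neq \mathrm{I}^{\otimes n_3}$, then $$\mathscr{T}_{\mathcal{Q}_U}(\mathcal{E}_P)=\mathbb{E}_{Q_2\in\{\mathrm{I},\mathrm{Z}\}^{\otimes n_2},\;Q_3\in\mathcal{P}_{n_3}\setminus\{\mathrm{I}^{\otimes n_3}\}}\left[\mathcal{E}_{W^\dagger(P_1\otimes Q_2\otimes Q_3)W}\right];$$ (iii) if $P_2\in\{\mathrm{I},\mathrm{Z}\}^{\otimes n_2}$ and $P_3=\mathrm{I}^{\otimes n_3}$, then $$\mathscr{T}_{\mathcal{Q}_U}(\mathcal{E}_P)=\mathcal{E}_P .$$
   Context: $\mathrm{I},\mathrm{X},\mathrm{Y},\mathrm{Z}$ are the single-qubit identity and Pauli matrices, and $\mathcal{P}_m=\{\mathrm{I},\mathrm{X},\mathrm{Y},\mathrm{Z}\}^{\otimes m}$ is the set of $4^m$ $m$-qubit Pauli operators (without phases). $\langle\cdot\rangle$ denotes the group generated by the elements inside the brackets; Pauli subgroups are considered up to phase. $\mathcal{G}_n$ is the $n$-qubit Clifford group (unitaries on $(\mathbb{C}^2)^{\otimes n}$ that map Pauli operators to Pauli operators up to phase under conjugation), elements being considered up to global phase, so that it is finite. The $\mathcal{Q}_U$-symmetric Clifford group is $\mathcal{G}_{n,\mathcal{Q}_U}=\{C\in\mathcal{G}_n \mid [C,R]=0 \text{ for all } R\in\mathcal{Q}_U\}$. For a unitary $D$, $\mathcal{D}(\cdot)=D\cdot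 D^\dagger$ and $\mathcal{D}^\dagger(\cdot)=D^\dagger\cdot D$. For any operator $V$ that is a Pauli operator up to phase, $\mathcal{E}_V(\cdot)=V\cdot V^\dagger$, which does not depend on the phase. $\mathbb{E}$ denotes the uniform average over the indicated finite set. It is a known fact that every Pauli subgroup admits a decomposition (up to phase) of the form used in the claim for some Clifford unitary $W$ and some $n_1+n_2+n_3=n$. *)

(* Defs.v *)
From HB Require Import structures.
From mathcomp Require Import all_boot all_order all_algebra.
From mathcomp Require Import finmap.
From mathcomp Require Import boolp classical_sets functions cardinality reals.
From mathcomp Require Export complex mxtens.

Set Implicit Arguments.
Unset Strict Implicit.
Unset Printing Implicit Defensive.

Import Order.TTheory GRing.Theory Num.Theory.
Local Open Scope classical_set_scope.
Local Open Scope ring_scope.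
Local Open Scope sesquilinear_scope.

(* An n-qubit operator is a complex matrix of size 2 ^ n, the basis of the
   tensor product being ordered lexicographically as in [tensmx]. *)
Notation "''Op[' C ]_ n" := 'M[C]_(2 ^ n)%N
  (at level 8, n at level 2, format "''Op[' C ]_ n") : type_scope.

(* The uniform average over a finite set A; it is 0 if A is empty or infinite. *)
Definition avg (C : fieldType) (V : lmodType C) (T : choiceType)
    (A : set T) (F : T -> V) : V :=
  (#|` fset_set A|%:R)^-1 *: \sum_(x <- fset_set A) F x.

Section Qubits.
Variable C : numClosedFieldType.

Definition pauliI : 'M[C]_2 := 1%:M.
Definition pauliX : 'M[C]_2 := \matrix_(i, j) (i != j)%:R.
Definition pauliY : 'M[C]_2 :=
  \matrix_(i, j) (if i == j then 0 else if i == ord0 then - 'i else 'i).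
Definition pauliZ : 'M[C]_2 :=
  \matrix_(i, j) (if i != j then 0 else if i == ord0 then 1 else -1).

(* S^{\otimes m} = { A_1 \otimes ... \otimes A_m | A_k \in S }. *)
Fixpoint tens_power (S : set 'M[C]_2) (m : nat) : set 'Op[C]_m :=
  match m with
  | 0 => [set 1%:M]
  | m'.+1 => [set castmx (esym (expnS 2 m'), esym (expnS 2 m')) (A *t B)
               | A in S & B in @tens_power S m']
  end.
Arguments tens_power S m : clear implicits.

Definition paulis (m : nat) : set 'Op[C]_m :=
  tens_power [set pauliI; pauliX; pauliY; pauliZ] m.
Definition IZ_strings (m : nat) : set 'Op[C]_m :=
  tens_power [set pauliI; pauliZ] m.
Definition I_strings (m : nat) : set 'Op[C]_m := tens_power [set pauliI] m.

Arguments paulis m : clear implicits.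
Arguments IZ_strings m : clear implicits.
Arguments I_strings m : clear implicits.

Lemma expn_sum3 n1 n2 n3 n :
  (n1 + n2 + n3)%N = n -> (2 ^ n1 * 2 ^ n2 * 2 ^ n3)%N = (2 ^ n)%N.
Proof. by move=> <-; rewrite !expnD. Qed.

Definition tens3 n1 n2 n3 n (hn : (n1 + n2 + n3)%N = n)
    (A1 : 'Op[C]_n1) (A2 : 'Op[C]_n2) (A3 : 'Op[C]_n3) : 'Op[C]_n :=
  castmx (expn_sum3 hn, expn_sum3 hn) ((A1 *t A2) *t A3).

Section FixedSize.
Variable n : nat.
Implicit Types (A B D P R U V W rho : 'Op[C]_n) (S Q : set 'Op[C]_n).

Definition phase_eq A B := exists c : C, `|c| = 1 /\ A = c *: B.
Definition phase_class A : set 'Op[C]_n := [set B | phase_eq B A].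
Definition mod_phase S : set (set 'Op[C]_n) := phase_class @` S.

Definition is_subgroup (H : set 'Op[C]_n) :=
  [/\ H `<=` [set A | A \in unitmx], H 1%:M,
      forall A B, H A -> H B -> H (A *m B)
    & forall A, H A -> H (invmx A)].
Definition generated S : set 'Op[C]_n := smallest is_subgroup S.

(* Q_U is generated by the support of the Pauli expansion of U; it may contain
   signs and phases, so it is only to be compared through [mod_phase]. *)
Definition pauli_group_of U : set 'Op[C]_n :=
  generated [set P | paulis n P /\ \tr (P *m U) != 0].

Definition clifford : set 'Op[C]_n :=
  [set D | D \is unitarymx /\
    forall P, paulis n P ->
      exists2 P', paulis n P' & phase_eq (D *m P *m D^t*) P'].
Definition sym_clifford Q : set 'Op[C]_n :=
  [set D | clifford D /\ forall R, Q R -> D *m R = R *m D].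

(* The map V . V^\dagger; it only depends on V up to phase. *)
Definition chan V (rho : 'Op[C]_n) : 'Op[C]_n := V *m rho *m V^t*.

(* The average is over the symmetric Clifford group modulo phase: K ranges
   over phase classes, and D is a representative of K, the choice of which
   does not affect the summand. *)
Definition twirl Q (Phi : 'Op[C]_n -> 'Op[C]_n) : 'Op[C]_n -> 'Op[C]_n :=
  avg (mod_phase (sym_clifford Q))
    (fun K => let D := xget 0 K in chan (D^t*) \o Phi \o chan D).

End FixedSize.
End Qubits.
Arguments paulis {C} m.
Arguments IZ_strings {C} m.
Arguments I_strings {C} m.
Arguments clifford {C n}.

(* Main.v *)
Require Import Defs.
From HB Require Import structures.
From mathcomp Require Import all_boot all_order all_algebra.
From mathcomp Require Import finmap ring.
From mathcomp Require Import boolp classical_sets functions cardinality reals.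

Set Implicit Arguments.
Unset Strict Implicit.
Unset Printing Implicit Defensive.

Import Order.TTheory GRing.Theory Num.Theory.
Local Open Scope classical_set_scope.
Local Open Scope ring_scope.
Local Open Scope sesquilinear_scope.

(* For D in the symmetric Clifford group G, chan D^* o chan P o chan D is the
   channel of D^* P D, so the twirl of chan P only depends on the G-orbit of P
   and is the uniform average over any finite G-stable family on which it is
   constant. After conjugation by W, the stabilizer commuting with G consists
   of the A (x) B (x) I with A a Pauli operator and B in {I, Z}^n2. Stability:
   D^* P D commutes or anticommutes with each stabilizer element exactly as P
   does, so P^* D^* P D commutes with the stabilizer and hence has the form I
   (x) B (x) E with B in {I, Z}^n2. Transitivity: if V is a Pauli operator
   commuting with the stabilizer and not with P, then exp (i pi V / 4) lies in
   G and maps P to P V up to phase, and two such moves connect any two members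
   of each family. Finiteness of G modulo phase holds because a Clifford
   operator is determined up to phase by its signed permutation of the Pauli
   operators. *)

(** * Algebra of conjugate transposes *)

Section Adjoint.
Variable C : numClosedFieldType.

Lemma adjmxM m n p (A : 'M[C]_(m, n)) (B : 'M[C]_(n, p)) :
  (A *m B)^t* = B^t* *m A^t*.
Proof. by rewrite trmx_mul map_mxM. Qed.

Lemma adjmxK m n (A : 'M[C]_(m, n)) : A^t*^t* = A.
Proof. by apply/matrixP => i j; rewrite !mxE conjCK. Qed.

Lemma adjmxZ m n c (A : 'M[C]_(m, n)) : (c *: A)^t* = c^* *: A^t*.
Proof. by apply/matrixP => i j; rewrite !mxE rmorphM. Qed.

Lemma adjmxD m n (A B : 'M[C]_(m, n)) : (A + B)^t* = A^t* + B^t*.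
Proof. by apply/matrixP => i j; rewrite !mxE rmorphD. Qed.

Lemma adjmx1 n : (1%:M : 'M[C]_n)^t* = 1%:M.
Proof. by rewrite trmx1 map_mx1. Qed.

Lemma unitary_mulVmx n (A : 'M[C]_n) : A \is unitarymx -> A^t* *m A = 1%:M.
Proof. by move=> /unitarymxP/mulmx1C. Qed.

End Adjoint.

(** * Equality of operators up to a phase *)

Section Phase.
Variables (C : numClosedFieldType) (n : nat).
Implicit Types A B D : 'Op[C]_n.

Lemma phase_eq_scale c A : `|c| = 1 -> phase_eq (c *: A) A.
Proof. by exists c. Qed.

Lemma phase_eq_refl A : phase_eq A A.
Proof. by exists 1; rewrite normr1 scale1r. Qed.

Lemma phase_eq_sym A B : phase_eq A B -> phase_eq B A.
Proof.
move=> [c [c1 ->]]; exists c^-1; rewrite normfV c1 invr1 scalerA mulVf ?scale1r //.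
by rewrite -normr_eq0 c1 oner_eq0.
Qed.

Lemma phase_eq_trans B A D : phase_eq A B -> phase_eq B D -> phase_eq A D.
Proof.
move=> [c [c1 ->]] [d [d1 ->]]; exists (c * d).
by rewrite normrM c1 d1 mulr1 scalerA.
Qed.

Lemma phase_eqM A A' B B' :
  phase_eq A A' -> phase_eq B B' -> phase_eq (A *m B) (A' *m B').
Proof.
move=> [c [c1 ->]] [d [d1 ->]]; exists (c * d).
by rewrite normrM c1 d1 mulr1 -scalemxAl -scalemxAr scalerA.
Qed.

Lemma phase_eq_adj A B : phase_eq A B -> phase_eq (A^t*) (B^t*).
Proof. by move=> [c [c1 ->]]; exists c^*; rewrite norm_conjC adjmxZ. Qed.

Lemma phase_eq_class A B : phase_eq A B -> phase_class A = phase_class B.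
Proof.
move=> AB; rewrite predeqE => D; split => DA.
  exact: phase_eq_trans DA AB.
exact: phase_eq_trans DA (phase_eq_sym AB).
Qed.

Lemma phase_class_inj A B : phase_class A = phase_class B -> phase_eq A B.
Proof. by move=> AB; have : phase_class A A by [exact: phase_eq_refl]; rewrite AB. Qed.

Lemma chan_phase A B : phase_eq A B -> chan A = chan B.
Proof.
move=> [c [c1 ->]]; apply/funext => rho; rewrite /chan adjmxZ.
by rewrite -scalemxAl -scalemxAl -scalemxAr scalerA -normCK c1 expr1n scale1r.
Qed.

End Phase.

(** * Single-qubit Pauli matrices *)

Section OneQubit.
Variable C : numClosedFieldType.
Local Notation I1 := (pauliI C).
Local Notation X := (pauliX C).
Local Notation Y := (pauliY C).
Local Notation Z := (pauliZ C).

(** Explicit entries turn identities between 2 x 2 matrices into scalar identities. *)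
Definition mx2 (a b c d : C) : 'M[C]_2 :=
  \matrix_(i, j) if i == ord0 then if j == ord0 then a else b
                 else if j == ord0 then c else d.

Lemma mx2E (A : 'M[C]_2) :
  A = mx2 (A ord0 ord0) (A ord0 ord_max) (A ord_max ord0) (A ord_max ord_max).
Proof.
apply/matrixP => i j; rewrite !mxE.
by case: (unliftP ord0 i) => [i' ->|->]; case: (unliftP ord0 j) => [j' ->|->] //=;
  congr (A _ _); apply: val_inj => /=; rewrite ?ord1.
Qed.

Lemma mx2M a b c d a' b' c' d' : mx2 a b c d *m mx2 a' b' c' d' =
  mx2 (a * a' + b * c') (a * b' + b * d') (c * a' + d * c') (c * b' + d * d').
Proof.
by apply/matrixP => i j; rewrite !mxE !big_ord_recl big_ord0 !mxE /=;
  case: ifP => _; case: ifP => _; rewrite addr0.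
Qed.

Lemma mx2Z x a b c d : x *: mx2 a b c d = mx2 (x * a) (x * b) (x * c) (x * d).
Proof. by apply/matrixP => i j; rewrite !mxE; do !case: ifP. Qed.

Lemma mx2D a b c d a' b' c' d' :
  mx2 a b c d + mx2 a' b' c' d' = mx2 (a + a') (b + b') (c + c') (d + d').
Proof. by apply/matrixP => i j; rewrite !mxE; do !case: ifP. Qed.

Lemma mx2_adj a b c d : (mx2 a b c d)^t* = mx2 a^* c^* b^* d^*.
Proof. by apply/matrixP => i j; rewrite !mxE; do !case: ifP. Qed.

Lemma pauliIE : I1 = mx2 1 0 0 1.
Proof. by rewrite [LHS]mx2E !mxE. Qed.
Lemma pauliXE : X = mx2 0 1 1 0.
Proof. by rewrite [LHS]mx2E !mxE. Qed.
Lemma pauliYE : Y = mx2 0 (- 'i) 'i 0.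
Proof. by rewrite [LHS]mx2E !mxE. Qed.
Lemma pauliZE : Z = mx2 1 0 0 (- 1).
Proof. by rewrite [LHS]mx2E !mxE. Qed.
Definition pauli_mx2E := (pauliIE, pauliXE, pauliYE, pauliZE).

Lemma mulii : 'i * 'i = - 1 :> C.
Proof. by rewrite -expr2 sqrCi. Qed.

Ltac table := rewrite !pauli_mx2E ?mx2Z !mx2M ?mx2Z;
  congr mx2; rewrite ?(mulr0, mul0r, mulr1, mul1r, addr0, add0r, mulrN, mulNr,
    mulii, opprK, oppr0).

Lemma pauliXX : X *m X = I1. Proof. by table. Qed.
Lemma pauliYY : Y *m Y = I1. Proof. by table. Qed.
Lemma pauliZZ : Z *m Z = I1. Proof. by table. Qed.
Lemma pauliXY : X *m Y = 'i *: Z. Proof. by table. Qed.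
Lemma pauliYX : Y *m X = (- 'i) *: Z. Proof. by table. Qed.
Lemma pauliYZ : Y *m Z = 'i *: X. Proof. by table. Qed.
Lemma pauliZY : Z *m Y = (- 'i) *: X. Proof. by table. Qed.
Lemma pauliZX : Z *m X = 'i *: Y. Proof. by table. Qed.
Lemma pauliXZ : X *m Z = (- 'i) *: Y. Proof. by table. Qed.
Lemma pauliIM (A : 'M[C]_2) : I1 *m A = A. Proof. exact: mul1mx. Qed.
Lemma pauliMI (A : 'M[C]_2) : A *m I1 = A. Proof. exact: mulmx1. Qed.

Definition pauli_mulE := (pauliIM, pauliMI, pauliXX, pauliYY, pauliZZ,
  pauliXY, pauliYX, pauliYZ, pauliZY, pauliZX, pauliXZ).

Definition pauli1 : set 'M[C]_2 := [set I1; X; Y; Z].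
Definition IZ1 : set 'M[C]_2 := [set I1; Z].

Lemma pauli1_X : pauli1 X. Proof. by left; left; right. Qed.
Lemma pauli1_Y : pauli1 Y. Proof. by left; right. Qed.
Lemma pauli1_Z : pauli1 Z. Proof. by right. Qed.
Lemma pauli1_I : pauli1 I1. Proof. by left; left; left. Qed.
Lemma IZ1_I : IZ1 I1. Proof. by left. Qed.
Lemma IZ1_Z : IZ1 Z. Proof. by right. Qed.
#[local] Hint Resolve pauli1_I pauli1_X pauli1_Y pauli1_Z IZ1_I IZ1_Z : core.

Lemma pauli1_sq A : pauli1 A -> A *m A = 1%:M.
Proof. by move=> [[[]|]|] ->; rewrite !pauli_mulE. Qed.

Lemma pauli1_adj A : pauli1 A -> A^t* = A.
Proof.
move=> [[[]|]|] ->; rewrite !pauli_mx2E mx2_adj;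
by rewrite ?rmorphN ?rmorph0 ?rmorph1 /= ?conjCi ?opprK.
Qed.

(** The index [n := 1] reads 2 x 2 matrices as single-qubit operators, so that [phase_eq] applies to
    them. *)
Lemma pauli1M A B : pauli1 A -> pauli1 B ->
  exists2 P, pauli1 P & phase_eq (n := 1) (A *m B) P.
Proof.
move=> [[[]|]|] -> [[[]|]|] ->; rewrite !pauli_mulE;
match goal with
| |- exists2 _, _ & phase_eq (_ *: ?A) _ =>
    by exists A => //; apply: phase_eq_scale; rewrite ?normrN normCi
| |- exists2 _, _ & phase_eq ?A _ => by exists A => //; apply: phase_eq_refl
end.
Qed.

Lemma pauli1_comm A B : pauli1 A -> pauli1 B ->
  A *m B = B *m A \/ A *m B = - (B *m A).
Proof.
by move=> [[[]|]|] -> [[[]|]|] ->; rewrite !pauli_mulE;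
  solve [by left | by right; rewrite -scaleNr ?opprK].
Qed.

(** For distinct A and B the product is X, Y or Z up to phase. X anticommutes with Y and Z, and Z
    with X, so one of X and Z always serves as witness. *)
Lemma pauli1_sep A B : pauli1 A -> pauli1 B -> A <> B ->
  exists2 T, pauli1 T & T *m (A *m B) = - (A *m B *m T).
Proof.
have anti T A' : pauli1 T -> T *m A' = - (A' *m T) ->
    exists2 T, pauli1 T & T *m A' = - (A' *m T) by exists T.
by move=> [[[]|]|] -> [[[]|]|] -> neqAB; (try by case: neqAB);
  rewrite !pauli_mulE;
  first [apply: (anti X) => //;
         by rewrite -?scalemxAr -?scalemxAl !pauli_mulE ?scaleNr ?scalerN ?opprK
        |apply: (anti Z) => //;
         by rewrite -?scalemxAr -?scalemxAl !pauli_mulE ?scaleNr ?scalerN ?opprK].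
Qed.

Lemma IZ1_sep A : pauli1 A -> ~ IZ1 A ->
  exists2 T, IZ1 T & T *m A = - (A *m T).
Proof.
by move=> [[[]|]|] -> notIZ; do ?[by case: notIZ]; exists Z => //;
  rewrite !pauli_mulE -scaleNr ?opprK.
Qed.

Lemma IZ1M A B : IZ1 A -> IZ1 B -> IZ1 (A *m B).
Proof. by move=> [] -> [] ->; rewrite !pauli_mulE. Qed.

Lemma IZ1_comm A B : IZ1 A -> IZ1 B -> A *m B = B *m A.
Proof. by move=> [] -> [] ->; rewrite !pauli_mulE. Qed.

Lemma pauli1_span (L : 'M[C]_2 -> Prop) :
  (forall A B, L A -> L B -> L (A + B)) -> (forall c A, L A -> L (c *: A)) ->
  (forall A, pauli1 A -> L A) -> forall A, L A.
Proof.
move=> LD LZ Lpauli A; rewrite [A]mx2E.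
set a := A _ _; set b := A _ _; set c := A _ _; set d := A _ _.
(* The coefficient of each Pauli matrix T is tr(T A) / 2. *)
have -> : mx2 a b c d = ((a + d) / 2) *: I1 + ((a - d) / 2) *: Z
      + ((b + c) / 2) *: X + ('i * (b - c) / 2) *: Y.
  rewrite !pauli_mx2E !mx2Z !mx2D; congr mx2; rewrite ?(mulr0, mulr1, addr0, add0r); try by field.
  (* [field] treats the imaginary unit as an indeterminate, so its square is isolated and replaced
     by -1. *)
  - have := mulii; move: 'i => i ii; have -> : i * (b - c) / 2 * - i = (- (i * i)) * (b - c) / 2 by field.
    by rewrite ii; field.
  - have := mulii; move: 'i => i ii; have -> : i * (b - c) / 2 * i = (i * i) * (b - c) / 2 by field.
    by rewrite ii; field.
have LZp c0 T : pauli1 T -> L (c0 *: T) by move=> pT; exact: LZ (Lpauli _ pT).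
by apply: (LD); [apply: (LD); [apply: (LD)|]|]; apply: (LZp).
Qed.
End OneQubit.

(** * Tensor powers of sets of matrices *)

Section CastTensor.
Variable C : numClosedFieldType.

(* The Kronecker product, with its size pq rewritten as r. *)
Definition tensc p q r (h : (p * q)%N = r) (A : 'M[C]_p) (B : 'M[C]_q) : 'M[C]_r :=
  castmx (h, h) (A *t B).

Section Ops.
Variables (p q r : nat) (h : (p * q)%N = r).
Implicit Types (A : 'M[C]_p) (B : 'M[C]_q).

Lemma tenscM A A' B B' :
  tensc h A B *m tensc h A' B' = tensc h (A *m A') (B *m B').
Proof. by case: _ / h; rewrite /tensc !castmx_id tensmx_mul. Qed.

Lemma tensc_adj A B : (tensc h A B)^t* = tensc h (A^t*) (B^t*).
Proof. by case: _ / h; rewrite /tensc !castmx_id trmx_tens map_mxT. Qed.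

Lemma tensc1 : tensc h 1%:M 1%:M = 1%:M.
Proof.
case: _ / h; rewrite /tensc castmx_id; apply/matrixP => i j.
case: (mxtens_indexP i) => i1 i2; case: (mxtens_indexP j) => j1 j2.
by rewrite tensmxE !mxE (can_eq (@mxtens_indexK _ _)) xpair_eqE -natrM mulnb.
Qed.

Lemma tenscZl c A B : tensc h (c *: A) B = c *: tensc h A B.
Proof.
by case: _ / h; rewrite /tensc !castmx_id; apply/matrixP => i j;
  rewrite !mxE mulrA.
Qed.

Lemma tenscZr c A B : tensc h A (c *: B) = c *: tensc h A B.
Proof.
by case: _ / h; rewrite /tensc !castmx_id; apply/matrixP => i j;
  rewrite !mxE mulrCA.
Qed.

Lemma tenscDl A A' B : tensc h (A + A') B = tensc h A B + tensc h A' B.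
Proof.
by case: _ / h; rewrite /tensc !castmx_id; apply/matrixP => i j;
  rewrite !mxE mulrDl.
Qed.

Lemma tenscDr A B B' : tensc h A (B + B') = tensc h A B + tensc h A B'.
Proof.
by case: _ / h; rewrite /tensc !castmx_id; apply/matrixP => i j;
  rewrite !mxE mulrDr.
Qed.

Lemma tenscNl A B : tensc h (- A) B = - tensc h A B.
Proof. by rewrite -scaleN1r tenscZl scaleN1r. Qed.

Lemma tenscNr A B : tensc h A (- B) = - tensc h A B.
Proof. by rewrite -scaleN1r tenscZr scaleN1r. Qed.

(** Matrix units are simple tensors; hence simple tensors span all operators. *)
Lemma delta_mx_tensc (i j : 'I_r) : exists i1 j1 i2 j2,
  delta_mx i j = tensc h (delta_mx i1 j1) (delta_mx i2 j2).
Proof.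
case: _ / h in i j *; rewrite /tensc.
case: (mxtens_indexP i) => i1 i2; case: (mxtens_indexP j) => j1 j2.
exists i1, j1, i2, j2; rewrite castmx_id; apply/matrixP => k l.
case: (mxtens_indexP k) => k1 k2; case: (mxtens_indexP l) => l1 l2.
rewrite tensmxE !mxE !(can_eq (@mxtens_indexK _ _)) !xpair_eqE -natrM mulnb.
by rewrite andbACA.
Qed.
End Ops.

Lemma tensc1l q (h : (1 * q)%N = q) (B : 'M[C]_q) : tensc h 1%:M B = B.
Proof.
rewrite /tensc tens_scalar1mx castmx_comp /= (eq_irrelevance (etrans _ _) erefl).
exact: castmx_id.
Qed.

Lemma tenscA p q s u u' v (h1 : (p * q)%N = u) (h2 : (u * s)%N = v)
    (h3 : (q * s)%N = u') (h4 : (p * u')%N = v) A B D :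
  tensc h2 (tensc h1 A B) D = tensc h4 A (tensc h3 B D).
Proof.
case: _ / h1 in h2 *; case: _ / h3 in h4 *; case: _ / h4 in h2 *.
rewrite /tensc !castmx_id; apply/matrixP => i j; rewrite castmxE !mxE mulrA.
(* Both bracketings read an index through the same three mixed-radix digits, compared here one at a
   time. *)
have outer (k : nat) : (k %/ s %/ q = k %/ (q * s))%N.
  by rewrite divnMA divnAC.
have middle (k : nat) : (k %/ s %% q = k %% (q * s) %/ s)%N.
  by rewrite modn_divl.
have inner (k : nat) : (k %% s = k %% (q * s) %% s)%N.
  by rewrite modn_dvdm ?dvdn_mull.
by congr (A _ _ * B _ _ * D _ _); apply: val_inj => /=.
Qed.
End CastTensor.

(** * Properties that tensor powers inherit factor by factor *)

Section TensorPower.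
Variable C : numClosedFieldType.
Implicit Types S : set 'M[C]_2.

Local Arguments tens_power {C} S m.
Local Notation tcons m := (tensc (esym (expnS 2 m))).

Lemma tens_power_cons S m A B :
  S A -> tens_power S m B -> tens_power S m.+1 (tcons m A B).
Proof. by move=> SA SB; exists A => //; exists B. Qed.

Lemma tens_power_1 S m : S 1%:M -> tens_power S m 1%:M.
Proof.
by move=> S1; elim: m => // m IH; rewrite -(tensc1 _ (esym (expnS 2 m)));
  apply: tens_power_cons.
Qed.

Lemma tens_power_sub S S' m :
  S `<=` S' -> tens_power S m `<=` tens_power S' m.
Proof.
move=> subS; elim: m => // m IH _ [A SA [B SB <-]].
by apply: tens_power_cons; [apply: subS | apply: IH].
Qed.

Lemma tens_powerM S m : (forall A B, S A -> S B -> S (A *m B)) ->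
  forall P Q, tens_power S m P -> tens_power S m Q -> tens_power S m (P *m Q).
Proof.
move=> SM; elim: m => [_ _ -> -> /=|m IH _ _ [A SA [B SB <-]] [A' SA' [B' SB' <-]]].
  by rewrite mulmx1.
by rewrite tenscM; apply: tens_power_cons; [apply: SM | apply: IH].
Qed.

Lemma tens_power_comm S m :
  (forall A B, S A -> S B -> A *m B = B *m A) ->
  forall P Q, tens_power S m P -> tens_power S m Q -> P *m Q = Q *m P.
Proof.
move=> Scomm.
elim: m => [_ _ -> -> //|m IH _ _ [A SA [B SB <-]] [A' SA' [B' SB' <-]]].
by rewrite !tenscM (Scomm A) // (IH B).
Qed.

Lemma tens_power_pm_comm S m :
  (forall A B, S A -> S B -> A *m B = B *m A \/ A *m B = - (B *m A)) ->
  forall P Q, tens_power S m P -> tens_power S m Q ->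
    P *m Q = Q *m P \/ P *m Q = - (Q *m P).
Proof.
move=> Scomm; elim: m => [_ _ -> ->|m IH _ _ [A SA [B SB <-]] [A' SA' [B' SB' <-]]].
  by left.
rewrite !tenscM; case: (Scomm A A') => // ->; case: (IH B B') => // ->.
- by left.
- by right; rewrite tenscNr.
- by right; rewrite tenscNl.
- by left; rewrite tenscNr tenscNl opprK.
Qed.

Lemma tens_powerM_phase S m :
  (forall A B, S A -> S B -> exists2 P, S P & phase_eq (n := 1) (A *m B) P) ->
  forall P Q, tens_power S m P -> tens_power S m Q ->
    exists2 T, tens_power S m T & phase_eq (P *m Q) T.
Proof.
move=> SM; elim: m => [_ _ -> ->|m IH _ _ [A SA [B SB <-]] [A' SA' [B' SB' <-]]].
  by exists 1%:M; rewrite // mulmx1; apply: phase_eq_refl.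
have [T ST [c [c1 AA']]] := SM _ _ SA SA'.
have [T' ST' [d [d1 BB']]] := IH _ _ SB SB'.
exists (tcons m T T'); first exact: tens_power_cons.
exists (c * d); rewrite normrM c1 d1 mulr1 tenscM AA' BB'.
by rewrite tenscZl tenscZr scalerA.
Qed.

Lemma tens_power_sq S m : (forall A, S A -> A *m A = 1%:M) ->
  forall P, tens_power S m P -> P *m P = 1%:M.
Proof.
move=> Ssq; elim: m => [_ -> /=|m IH _ [A SA [B SB <-]]]; first by rewrite mulmx1.
by rewrite tenscM Ssq // IH // tensc1.
Qed.

Lemma tens_power_adj S m : (forall A, S A -> A^t* = A) ->
  forall P, tens_power S m P -> P^t* = P.
Proof.
move=> Sadj; elim: m => [_ -> /=|m IH _ [A SA [B SB <-]]]; first exact: adjmx1.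
by rewrite tensc_adj Sadj // IH.
Qed.

(** D carries an anticommuting matrix on the first factor of P outside S' and the identity
    elsewhere, so exactly one sign appears. *)
Lemma tens_power_anti S S' T m : T 1%:M ->
  (forall A, S A -> ~ S' A -> exists2 D, T D & D *m A = - (A *m D)) ->
  forall P, tens_power S m P -> ~ tens_power S' m P ->
    exists2 D, tens_power T m D & D *m P = - (P *m D).
Proof.
move=> T1 anti; elim: m => [_ -> /= //|m IH _ [A SA [B SB <-]] notS'].
have [S'A|nS'A] := pselect (S' A); last first.
  have [D TD DA] := anti A SA nS'A.
  exists (tcons m D 1%:M); first by apply: tens_power_cons => //; apply: tens_power_1.
  by rewrite !tenscM mulmx1 mul1mx DA tenscNl.
have nS'B : ~ tens_power S' m B by move=> S'B; apply/notS'/tens_power_cons.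
have [D TD DB] := IH B SB nS'B.
exists (tcons m 1%:M D); first exact: tens_power_cons.
by rewrite !tenscM mulmx1 mul1mx DB tenscNr.
Qed.

(** The anticommuting matrix now sits on the first factor where P and Q differ; the identity fills
    the other factors. *)
Lemma tens_power_anti2 S m : S 1%:M ->
  (forall A B, S A -> S B -> A <> B ->
    exists2 D, S D & D *m (A *m B) = - (A *m B *m D)) ->
  forall P Q, tens_power S m P -> tens_power S m Q -> P <> Q ->
    exists2 D, tens_power S m D & D *m (P *m Q) = - (P *m Q *m D).
Proof.
move=> S1 anti; elim: m => [_ _ -> -> //|m IH].
move=> _ _ [A SA [B SB <-]] [A' SA' [B' SB' <-]] neq.
have [AA'|AA'] := pselect (A = A'); last first.
  have [D SD DA] := anti _ _ SA SA' AA'.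
  exists (tcons m D 1%:M); first by apply: tens_power_cons => //; apply: tens_power_1.
  by rewrite !tenscM mulmx1 mul1mx DA tenscNl.
have BB' : B <> B' by move=> BB'; apply: neq; rewrite AA' BB'.
have [D SD DB] := IH _ _ SB SB' BB'.
exists (tcons m 1%:M D); first exact: tens_power_cons.
by rewrite !tenscM mulmx1 mul1mx DB tenscNr.
Qed.

Lemma tens_powerD S a b (h : (2 ^ a * 2 ^ b)%N = (2 ^ (a + b))%N) :
  tens_power S (a + b) =
    [set tensc h A B | A in tens_power S a & B in tens_power S b].
Proof.
elim: a h => [|a IH] h.
  rewrite predeqE => P; split=> [SP|[_ -> [B SB <-]]].
    by exists 1%:M => //; exists P => //; rewrite [LHS]tensc1l.
  by rewrite [tensc _ _ _]tensc1l.
have h' : (2 ^ a * 2 ^ b)%N = (2 ^ (a + b))%N by rewrite expnD.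
rewrite predeqE => P; split=> [[A SA [B SB <-]]|[_ [A SA [B SB <-]] [D SD <-]]].
  have := SB : tens_power S (a + b) B; rewrite (IH h') => -[B1 SB1 [B2 SB2 <-]].
  exists (tcons a A B1); first exact: tens_power_cons.
  by exists B2 => //; apply: tenscA.
rewrite (tenscA _ _ h' (esym (expnS 2 (a + b)))).
by apply: (tens_power_cons (m := a + b)) => //; rewrite (IH h'); exists B => //; exists D.
Qed.

Lemma tens_power_finite S m : finite_set S -> finite_set (tens_power S m).
Proof.
move=> Sfin; elim: m => [|m IH] /=; first exact: finite_set1.
exact: finite_image2.
Qed.

(** Spanning is phrased as induction over predicates closed under linear combinations. One induction
    per tensor slot reaches all simple tensors; sums of matrix units then reach every operator. *)
Lemma tens_power_span S :
  (forall L : 'M[C]_2 -> Prop,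
    (forall A B, L A -> L B -> L (A + B)) -> (forall c A, L A -> L (c *: A)) ->
    (forall A, S A -> L A) -> forall A, L A) ->
  forall m (L : 'Op[C]_m -> Prop),
    (forall A B, L A -> L B -> L (A + B)) -> (forall c A, L A -> L (c *: A)) ->
    (forall A, tens_power S m A -> L A) -> forall A, L A.
Proof.
move=> span; elim=> [|m IH] L LD LZ LS A.
  have -> : A = A ord0 ord0 *: 1%:M.
    by apply/matrixP => i j; rewrite !mxE !ord1 eqxx mulr1.
  exact: LZ (LS _ erefl).
have Ltens A' B' : L (tcons m A' B').
  apply: (span (fun A => L (tcons m A B'))) => {A'} [A1 A2 L1 L2|c A1 L1|A' SA'].
  - by rewrite tenscDl; apply: LD.
  - by rewrite tenscZl; apply: LZ.
  apply: (IH (fun B => L (tcons m A' B))) => {B'} [A1 A2 L1 L2|c A1 L1|B' SB'].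
  - by rewrite tenscDr; apply: LD.
  - by rewrite tenscZr; apply: LZ.
  by apply: LS; apply: tens_power_cons.
have L0 : L 0 by rewrite -(scale0r (tcons m 0 0)); apply: LZ.
rewrite [A]matrix_sum_delta.
apply: (big_ind L) => // i _; apply: (big_ind L) => // j _.
have [i1 [j1 [i2 [j2 ->]]]] := delta_mx_tensc C (esym (expnS 2 m)) i j.
exact: LZ.
Qed.
End TensorPower.

(** * Pauli operators up to phase *)

Section Paulis.
Variable C : numClosedFieldType.

Lemma op1_neqN1 m : (1%:M : 'Op[C]_m) <> - 1%:M.
Proof.
have m0 : (0 < 2 ^ m)%N by rewrite expn_gt0.
move=> /matrixP/(_ (Ordinal m0) (Ordinal m0)); rewrite !mxE eqxx mulr1n => /eqP.
by rewrite -subr_eq0 opprK -mulr2n pnatr_eq0.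
Qed.

(** A product of unitaries is invertible, hence differs from its opposite. This contradiction is
    what later identifies Pauli factors. *)
Lemma unitary_comm_anti m (A B : 'Op[C]_m) :
  A \is unitarymx -> B \is unitarymx ->
  A *m B = B *m A -> A *m B = - (B *m A) -> False.
Proof.
move=> uA uB comm anti; apply: (@op1_neqN1 m).
have /unitarymxP <- : B *m A \is unitarymx by apply: mul_unitarymx.
by rewrite -mulNmx -anti comm.
Qed.

Lemma paulis_1 m : paulis m (1%:M : 'Op[C]_m).
Proof. by apply: tens_power_1; left; left; left. Qed.

Lemma paulis_sq m (P : 'Op[C]_m) : paulis m P -> P *m P = 1%:M.
Proof. exact: tens_power_sq (@pauli1_sq C) P. Qed.

Lemma paulis_adj m (P : 'Op[C]_m) : paulis m P -> P^t* = P.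
Proof. exact: tens_power_adj (@pauli1_adj C) P. Qed.

Lemma paulis_unitary m (P : 'Op[C]_m) : paulis m P -> P \is unitarymx.
Proof. by move=> pP; apply/unitarymxP; rewrite paulis_adj // paulis_sq. Qed.

Lemma paulisM m (P Q : 'Op[C]_m) : paulis m P -> paulis m Q ->
  exists2 T, paulis m T & phase_eq (P *m Q) T.
Proof. exact: tens_powerM_phase (@pauli1M C) P Q. Qed.

Lemma paulis_comm m (P Q : 'Op[C]_m) : paulis m P -> paulis m Q ->
  P *m Q = Q *m P \/ P *m Q = - (Q *m P).
Proof. exact: tens_power_pm_comm (@pauli1_comm C) P Q. Qed.

Lemma paulis_sep m (P Q : 'Op[C]_m) : paulis m P -> paulis m Q -> P <> Q ->
  exists2 D, paulis m D & D *m (P *m Q) = - (P *m Q *m D).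
Proof. exact: tens_power_anti2 (pauli1_I C) (@pauli1_sep C) P Q. Qed.

Lemma paulis_neq1_anti m (P : 'Op[C]_m) : paulis m P -> P <> 1%:M ->
  exists2 D, paulis m D & D *m P = - (P *m D).
Proof.
move=> pP P1; have [D pD] := paulis_sep pP (paulis_1 m) P1.
by rewrite mulmx1; exists D.
Qed.

(** If P and Q differed, some Pauli operator would anticommute with P Q, yet P Q is a scalar
    multiple of P P = I. *)
Lemma paulis_phase_inj m (P Q : 'Op[C]_m) :
  paulis m P -> paulis m Q -> phase_eq P Q -> P = Q.
Proof.
move=> pP pQ [c [c1 PQ]]; apply: contrapT => neq.
have [D pD anti] := paulis_sep pP pQ neq.
apply: (@unitary_comm_anti _ D (P *m Q)) => //.
- exact: paulis_unitary.
- by apply: mul_unitarymx; apply: paulis_unitary.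
- by rewrite PQ -scalemxAl paulis_sq // -scalemxAl -scalemxAr mulmx1 mul1mx.
Qed.

Lemma paulis_finite m : finite_set (paulis m : set 'Op[C]_m).
Proof.
by apply: tens_power_finite; do !(rewrite finite_setU; split); apply: finite_set1.
Qed.

(** Pauli operators span the whole matrix algebra, so M is central, hence scalar, and unitarity
    gives the scalar modulus 1. *)
Lemma commutant_paulis m (M : 'Op[C]_m) : M \is unitarymx ->
  (forall P, paulis m P -> M *m P = P *m M) -> phase_eq M 1%:M.
Proof.
move=> uM comm.
have {}comm X : M *m X = X *m M.
  apply: (tens_power_span (@pauli1_span C) (L := fun X => M *m X = X *m M)).
  - by move=> A B MA MB; rewrite mulmxDl mulmxDr MA MB.
  - by move=> c A MA; rewrite -scalemxAr -scalemxAl MA.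
  - exact: comm.
have m0 : (0 < 2 ^ m)%N by rewrite expn_gt0.
pose o := Ordinal m0.
have scal : M = M o o *: 1%:M.
  (* Let E be the matrix unit at (i, o). Entry (k, o) of M E is M k i, while that of E M is M o o if
     k = i and 0 otherwise. *)
  apply/matrixP => k i; have /matrixP/(_ k o) := comm (delta_mx i o).
  rewrite !mxE (bigD1 i) //= big1 ?addr0; last first.
    by move=> j ji; rewrite mxE (negPf ji) mulr0.
  rewrite (bigD1 o) //= big1 ?addr0; last first.
    by move=> j jo; rewrite mxE (negPf jo) andbF mul0r.
  by rewrite !mxE !eqxx !andbT mulr1 => ->; rewrite mulrC.
exists (M o o); split=> //.
have /unitarymxP := uM; rewrite scal adjmxZ adjmx1 !mxE eqxx mulr1.
rewrite -scalemxAl -scalemxAr mulmx1 scalerA -normCK.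
move=> /matrixP/(_ o o); rewrite !mxE eqxx mulr1 => /eqP.
by rewrite sqrf_eq1 => /orP[] /eqP // Mo; have := normr_ge0 (M o o); rewrite Mo ler0N1.
Qed.

Lemma IZ_1 m : IZ_strings m (1%:M : 'Op[C]_m).
Proof. by apply: tens_power_1; left. Qed.

Lemma IZ_paulis m (P : 'Op[C]_m) : IZ_strings m P -> paulis m P.
Proof. by apply: tens_power_sub => A []; [left; left; left | right]. Qed.

Lemma IZ_M m (P Q : 'Op[C]_m) :
  IZ_strings m P -> IZ_strings m Q -> IZ_strings m (P *m Q).
Proof. exact: tens_powerM (@IZ1M C) P Q. Qed.

Lemma IZ_comm m (P Q : 'Op[C]_m) :
  IZ_strings m P -> IZ_strings m Q -> P *m Q = Q *m P.
Proof. exact: tens_power_comm (@IZ1_comm C) P Q. Qed.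

Lemma IZ_sep m (P : 'Op[C]_m) : paulis m P -> ~ IZ_strings m P ->
  exists2 D, IZ_strings m D & D *m P = - (P *m D).
Proof. exact: tens_power_anti (IZ1_I C) (@IZ1_sep C) P. Qed.

Lemma IZ_finite m : finite_set (IZ_strings m : set 'Op[C]_m).
Proof. exact: sub_finite_set (@IZ_paulis m) (paulis_finite m). Qed.

(** Products of Pauli operators leave [paulis] by a phase; this saturation is stable under products,
    adjoints and Clifford conjugation. *)
Definition ppauli m (A : 'Op[C]_m) := exists2 P, paulis m P & phase_eq A P.

Lemma ppauliW m (P : 'Op[C]_m) : paulis m P -> ppauli P.
Proof. by move=> pP; exists P => //; apply: phase_eq_refl. Qed.

Lemma ppauliM m (A B : 'Op[C]_m) : ppauli A -> ppauli B -> ppauli (A *m B).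
Proof.
move=> [P pP AP] [Q pQ BQ]; have [T pT PQ] := paulisM pP pQ.
by exists T => //; apply: phase_eq_trans PQ; apply: phase_eqM.
Qed.

Lemma ppauli_adj m (A : 'Op[C]_m) : ppauli A -> ppauli (A^t*).
Proof.
move=> [P pP AP]; exists P => //.
by rewrite -(paulis_adj pP); apply: phase_eq_adj.
Qed.

Lemma phase_unitary m (A B : 'Op[C]_m) :
  phase_eq A B -> B \is unitarymx -> A \is unitarymx.
Proof.
move=> [c [c1 ->]] /unitarymxP uB; apply/unitarymxP.
by rewrite adjmxZ -scalemxAl -scalemxAr scalerA -normCK c1 expr1n scale1r.
Qed.

Lemma ppauli_unitary m (A : 'Op[C]_m) : ppauli A -> A \is unitarymx.
Proof. by move=> [P pP AP]; apply: phase_unitary AP (paulis_unitary pP). Qed.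

Lemma ppauli_comm m (A B : 'Op[C]_m) : ppauli A -> ppauli B ->
  A *m B = B *m A \/ A *m B = - (B *m A).
Proof.
move=> [P pP [c [_ ->]]] [Q pQ [d [_ ->]]].
rewrite -!scalemxAl -!scalemxAr !scalerA (mulrC d) -scalerN.
by case: (paulis_comm pP pQ) => ->; [left | right].
Qed.

(** * Pauli operators on a register split into three blocks *)

Section Tens3.
Variables (n1 n2 n3 n : nat) (hn : (n1 + n2 + n3)%N = n).
Implicit Types (A : 'Op[C]_n1) (B : 'Op[C]_n2) (D : 'Op[C]_n3).

Lemma tens3E A B D :
  tens3 hn A B D = tensc (expn_sum3 hn) (tensc erefl A B) D.
Proof. by rewrite /tensc castmx_id. Qed.

Lemma tens3M A A' B B' D D' : tens3 hn A B D *m tens3 hn A' B' D' =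
  tens3 hn (A *m A') (B *m B') (D *m D').
Proof. by rewrite !tens3E !tenscM. Qed.

Lemma tens3_1 : tens3 hn 1%:M 1%:M 1%:M = 1%:M :> 'Op[C]_n.
Proof. by rewrite tens3E !tensc1. Qed.

Lemma tens3_phase A A' B B' D D' : phase_eq A A' -> phase_eq B B' ->
  phase_eq D D' -> phase_eq (tens3 hn A B D) (tens3 hn A' B' D').
Proof.
move=> [a [a1 ->]] [b [b1 ->]] [d [d1 ->]]; exists (d * (b * a)).
split; first by rewrite !normrM a1 b1 d1 !mulr1.
by rewrite !tens3E !(tenscZl, tenscZr) !scalerA; congr (_ *: _); ring.
Qed.

Lemma tens3N1 A B D : tens3 hn (- A) B D = - tens3 hn A B D.
Proof. by rewrite !tens3E !tenscNl. Qed.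

Lemma tens3N2 A B D : tens3 hn A (- B) D = - tens3 hn A B D.
Proof. by rewrite !tens3E tenscNr tenscNl. Qed.

Lemma tens3N3 A B D : tens3 hn A B (- D) = - tens3 hn A B D.
Proof. by rewrite !tens3E tenscNr. Qed.

Lemma paulis_tens3 (P : 'Op[C]_n) : paulis n P <->
  exists A B D, [/\ paulis n1 A, paulis n2 B, paulis n3 D & P = tens3 hn A B D].
Proof.
have h12 : (2 ^ n1 * 2 ^ n2)%N = (2 ^ (n1 + n2))%N by rewrite expnD.
(* [tens3] forms its inner product at size 2 ^ n1 * 2 ^ n2, whereas splitting a tensor power yields
   size 2 ^ (n1 + n2); the two casts must be reconciled. *)
have assoc (h : (2 ^ (n1 + n2) * 2 ^ n3)%N = (2 ^ n)%N) A B D :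
    tensc h (tensc h12 A B) D = tens3 hn A B D.
  rewrite tens3E; move: h (expn_sum3 hn); case: _ / h12 => h h'.
  by rewrite (eq_irrelevance h h').
move: assoc P; case: _ / hn => assoc P; rewrite /paulis.
have h : (2 ^ (n1 + n2) * 2 ^ n3)%N = (2 ^ (n1 + n2 + n3))%N by rewrite -expnD.
rewrite (tens_powerD _ h) (tens_powerD _ h12); split.
  move=> [_ [A pA [B pB <-]] [D pD <-]]; exists A, B, D; split=> //.
move=> [A [B [D [pA pB pD ->]]]]; exists (tensc h12 A B); first by exists A => //; exists B.
by exists D => //; apply: assoc.
Qed.

Lemma ppauli_tens3 A B D : ppauli A -> ppauli B -> ppauli D ->
  ppauli (tens3 hn A B D).
Proof.
move=> [P pP AP] [Q pQ BQ] [T pT DT]; exists (tens3 hn P Q T).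
  by apply/paulis_tens3; exists P, Q, T.
exact: tens3_phase.
Qed.

(** The product of the two operators is scalar, so it commutes with everything. A differing factor
    would give a Pauli operator, supported on that block, anticommuting with it. *)
Lemma tens3_inj A A' B B' D D' : paulis n1 A -> paulis n1 A' ->
  paulis n2 B -> paulis n2 B' -> paulis n3 D -> paulis n3 D' ->
  phase_eq (tens3 hn A B D) (tens3 hn A' B' D') -> [/\ A = A', B = B' & D = D'].
Proof.
move=> pA pA' pB pB' pD pD' eqP.
have p1 := ppauliW (paulis_1 _).
have uAA' : tens3 hn A B D *m tens3 hn A' B' D' \is unitarymx.
  by apply: mul_unitarymx; apply: ppauli_unitary; apply: ppauli_tens3; apply: ppauliW.
have AA' : exists c, tens3 hn A B D *m tens3 hn A' B' D' = c *: 1%:M.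
  case: eqP => c [_ ->]; exists c.
  by rewrite -scalemxAl tens3M !paulis_sq // tens3_1.
have key (T : 'Op[C]_n) : ppauli T ->
  T *m (tens3 hn A B D *m tens3 hn A' B' D') =
    - (tens3 hn A B D *m tens3 hn A' B' D' *m T) -> False.
  move=> /ppauli_unitary uT; apply: unitary_comm_anti => //.
  by case: AA' => c ->; rewrite -scalemxAl -scalemxAr mulmx1 mul1mx.
split; apply: contrapT.
- move=> /(paulis_sep pA pA') [T pT anti].
  apply: (key (tens3 hn T 1%:M 1%:M)); first by apply: ppauli_tens3 => //; apply: ppauliW.
  by rewrite !tens3M anti tens3N1 !mulmx1 !mul1mx.
- move=> /(paulis_sep pB pB') [T pT anti].
  apply: (key (tens3 hn 1%:M T 1%:M)); first by apply: ppauli_tens3 => //; apply: ppauliW.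
  by rewrite !tens3M anti tens3N2 !mulmx1 !mul1mx.
- move=> /(paulis_sep pD pD') [T pT anti].
  apply: (key (tens3 hn 1%:M 1%:M T)); first by apply: ppauli_tens3 => //; apply: ppauliW.
  by rewrite !tens3M anti tens3N3 !mulmx1 !mul1mx.
Qed.

End Tens3.
End Paulis.

(** * Averages over finite sets *)

Section Average.

Lemma perm_fset_set_map (T : choiceType) (A : set T) (s : T -> T) :
  finite_set A -> (forall x, A x -> A (s x)) ->
  (forall x y, A x -> A y -> s x = s y -> x = y) ->
  perm_eq [seq s x | x <- fset_set A] (fset_set A).
Proof.
move=> finA sA inj; set X := fset_set A.
have inX x : (x \in X) = (x \in A) by rewrite in_fset_set.
have uniqs : uniq [seq s x | x <- X].
  rewrite map_inj_in_uniq ?fset_uniq // => x y; rewrite !inX !inE; exact: inj.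
apply: uniq_perm => //.
have subX : {subset [seq s x | x <- X] <= X}.
  by move=> _ /mapP[x xX ->]; move: xX; rewrite !inX !inE; apply: sA.
by have [] := uniq_min_size uniqs subX; rewrite ?size_map.
Qed.

(** Used to invert the action of a Clifford operator on the Pauli operators. *)
Lemma finite_inj_surj (T : choiceType) (A : set T) (s : T -> T) :
  finite_set A -> (forall x, A x -> A (s x)) ->
  (forall x y, A x -> A y -> s x = s y -> x = y) ->
  forall y, A y -> exists2 x, A x & s x = y.
Proof.
move=> finA sA inj y Ay.
have : y \in fset_set A by rewrite in_fset_set ?inE.
rewrite -(perm_mem (perm_fset_set_map finA sA inj)) => /mapP[x].
by rewrite in_fset_set // inE => Ax ->; exists x.
Qed.

Variables (C : numFieldType) (V : lmodType C).

Lemma eq_avg (T : choiceType) (A : set T) (F G : T -> V) : finite_set A ->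
  (forall x, A x -> F x = G x) -> avg A F = avg A G.
Proof.
move=> finA FG; rewrite /avg; congr (_ *: _).
apply: eq_big_seq => x; rewrite in_fset_set // inE; exact: FG.
Qed.

Lemma avg_reindex (T : choiceType) (A : set T) (s : T -> T) (F : T -> V) :
  finite_set A -> (forall x, A x -> A (s x)) ->
  (forall x y, A x -> A y -> s x = s y -> x = y) ->
  avg A (fun x => F (s x)) = avg A F.
Proof.
move=> finA sA inj; rewrite /avg; congr (_ *: _).
by rewrite -(big_map s xpredT F); apply: perm_big; apply: perm_fset_set_map.
Qed.

Lemma avg_const (T : choiceType) (A : set T) (v : V) :
  finite_set A -> A !=set0 -> avg A (fun=> v) = v.
Proof.
move=> finA [x Ax]; rewrite /avg big_const_seq count_predT iter_addr_0.
rewrite -scaler_nat scalerA mulVf ?scale1r // pnatr_eq0 -lt0n.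
have : x \in fset_set A by rewrite in_fset_set ?inE.
by move=> xA; rewrite cardfs_gt0; apply/fset0Pn; exists x.
Qed.

Lemma avg_exchange (T T' : choiceType) (A : set T) (B : set T') (F : T -> T' -> V) :
  avg A (fun x => avg B (F x)) = avg B (fun y => avg A (F^~ y)).
Proof.
by rewrite /avg -!scaler_sumr exchange_big /= !scalerA mulrC.
Qed.
End Average.

(** * The Clifford group modulo phase *)

Section Clifford.
Variables (C : numClosedFieldType) (n : nat).
Implicit Types (A B D E P X : 'Op[C]_n).

Lemma conj_unitaryM D A B : D \is unitarymx ->
  D^t* *m (A *m B) *m D = (D^t* *m A *m D) *m (D^t* *m B *m D).
Proof.
move=> /unitarymxP uD; rewrite !mulmxA; congr (_ *m _ *m _).
by rewrite -(mulmxA _ D) uD mulmx1.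
Qed.

Lemma phase_eq_conj D A B : phase_eq A B ->
  phase_eq (D^t* *m A *m D) (D^t* *m B *m D).
Proof.
move=> AB; exact: phase_eqM (phase_eqM (phase_eq_refl _) AB) (phase_eq_refl _).
Qed.

Lemma clifford_conj D A : clifford D -> ppauli A -> ppauli (D *m A *m D^t*).
Proof.
move=> [_ DP] [P pP AP]; have [P' pP' DPP'] := DP P pP; exists P' => //.
apply: phase_eq_trans DPP'.
exact: phase_eqM (phase_eqM (phase_eq_refl _) AP) (phase_eq_refl _).
Qed.

Lemma clifford1 : clifford (1%:M : 'Op[C]_n).
Proof.
split; first by apply/unitarymxP; rewrite adjmx1 mulmx1.
by move=> P pP; exists P => //; rewrite adjmx1 mulmx1 mul1mx; apply: phase_eq_refl.
Qed.

Lemma cliffordM D E : clifford D -> clifford E -> clifford (D *m E).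
Proof.
move=> cD cE; split; first by apply: mul_unitarymx; [case: cD | case: cE].
move=> P pP.
have -> : D *m E *m P *m (D *m E)^t* = D *m (E *m P *m E^t*) *m D^t*.
  by rewrite adjmxM !mulmxA.
by do 2!apply: clifford_conj => //; apply: ppauliW.
Qed.

(* Conjugation by D permutes the finite set of Pauli operators up to phase,
   and the inverse permutation is conjugation by the adjoint of D. *)
Lemma clifford_adj D : clifford D -> clifford (D^t*).
Proof.
move=> [uD DP]; split; first by rewrite trmxC_unitary.
have /choice[f fP] (P : 'Op[C]_n) : exists P', paulis n P ->
    paulis n P' /\ phase_eq (D *m P *m D^t*) P'.
  have [pP|npP] := pselect (paulis n P); last by exists P.
  by have [P' pP' DPP'] := DP P pP; exists P'.
have unconj P : D^t* *m (D *m P *m D^t*) *m D = P.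
  by rewrite !mulmxA unitary_mulVmx // mul1mx -mulmxA unitary_mulVmx // mulmx1.
have finj P Q : paulis n P -> paulis n Q -> f P = f Q -> P = Q.
  move=> pP pQ fPQ; apply: paulis_phase_inj => //.
  rewrite -(unconj P) -(unconj Q); apply: phase_eq_conj.
  have [_ fP1] := fP P pP; have [_ fQ1] := fP Q pQ.
  by apply: phase_eq_trans fP1 _; rewrite fPQ; apply: phase_eq_sym.
move=> P pP; rewrite adjmxK.
have [Q pQ fQ] := finite_inj_surj (paulis_finite C n) (fun P pP => proj1 (fP P pP)) finj pP.
exists Q => //; rewrite -[X in phase_eq _ X]unconj; apply: phase_eq_conj.
by rewrite -fQ; apply: phase_eq_sym; case: (fP Q pQ).
Qed.

Lemma clifford_phase D E : phase_eq D E -> clifford E -> clifford D.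
Proof.
move=> DE [uE EP]; split; first exact: phase_unitary DE uE.
move=> P pP; have [P' pP' EPP'] := EP P pP; exists P' => //.
apply: phase_eq_trans EPP'.
by apply: phase_eqM; [apply: phase_eqM => //; exact: phase_eq_refl | exact: phase_eq_adj].
Qed.

(* The phase in D P D^* is a sign because P and its conjugate square to 1. *)
Lemma clifford_conj_sign D P : clifford D -> paulis n P ->
  exists2 P', paulis n P' & exists b : bool, D *m P *m D^t* = (-1) ^+ b *: P'.
Proof.
move=> [uD DP] pP; have [P' pP' [c [c1 DPP']]] := DP P pP; exists P' => //.
have : (D *m P *m D^t*) *m (D *m P *m D^t*) = 1%:M.
  rewrite !mulmxA -(mulmxA _ (D^t*) D) unitary_mulVmx // mulmx1.
  by rewrite -(mulmxA D P) paulis_sq // mulmx1; apply/unitarymxP.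
rewrite DPP' -scalemxAl -scalemxAr paulis_sq // scalerA => cc1.
have m0 : (0 < 2 ^ n)%N by rewrite expn_gt0.
move/matrixP/(_ (Ordinal m0) (Ordinal m0)): cc1; rewrite !mxE eqxx mulr1 -expr2 => /eqP.
rewrite mulr1n sqrf_eq1 => /orP[] /eqP ->; first by exists false.
by exists true.
Qed.

(** E^* D commutes with every Pauli operator, hence is a phase. *)
Lemma clifford_same_action D E : D \is unitarymx -> E \is unitarymx ->
  (forall P, paulis n P -> D *m P *m D^t* = E *m P *m E^t*) -> phase_eq D E.
Proof.
move=> uD uE DE.
have : phase_eq (E^t* *m D) 1%:M.
  apply: commutant_paulis => [|P pP].
    by apply: mul_unitarymx => //; rewrite trmxC_unitary.
  have /(congr1 (fun M => E^t* *m M *m D)) := DE P pP.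
  rewrite !mulmxA unitary_mulVmx // mul1mx => <-.
  by rewrite -!mulmxA unitary_mulVmx // mulmx1.
move=> /(phase_eqM (phase_eq_refl E)).
by rewrite mulmxA (unitarymxP uE) mul1mx mulmx1.
Qed.

(** Each phase class is recovered as [acts phi], the set of unitaries realizing a map [phi] from
    Pauli operators to signed Pauli operators, and there are finitely many such maps. *)
Lemma clifford_finite : finite_set (mod_phase (clifford : set 'Op[C]_n)).
Proof.
pose s := fset_set (paulis n : set 'Op[C]_n).
have ins P : P \in s <-> paulis n P.
  by rewrite in_fset_set ?inE //; apply: paulis_finite.
pose acts (phi : {ffun s -> s * bool}) : set 'Op[C]_n := [set D | D \is unitarymx /\
  forall P : s, D *m val P *m D^t* = (-1) ^+ (phi P).2 *: val (phi P).1].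
apply: (@sub_finite_set _ _ (range acts)); last exact: finite_image.
move=> _ [D cD <-].
have /choice[phi phiP] (P : s) : exists Qb : s * bool,
    D *m val P *m D^t* = (-1) ^+ Qb.2 *: val Qb.1.
  have /ins pP := valP P.
  have [P' /ins pP' [b DP]] := clifford_conj_sign cD pP.
  by exists ([` pP']%fset, b).
exists (finfun phi) => //; rewrite predeqE => E; split.
- move=> [uE EP]; apply: clifford_same_action => //; first by case: cD.
  by move=> P /ins pP; have := EP [` pP]%fset; rewrite ffunE -phiP.
- move=> ED; split; first by apply: phase_unitary ED _; case: cD.
  by move=> P; rewrite ffunE -phiP; have := chan_phase ED => /(congr1 (fun F => F (val P))).
Qed.
End Clifford.

(** * Orbits and transvections *)

Section Twirl.
Variables (C : numClosedFieldType) (n : nat) (S : set 'Op[C]_n).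
Implicit Types (D E P A V X : 'Op[C]_n).
Local Notation G := (sym_clifford S).

Lemma sym_clifford1 : G 1%:M.
Proof. by split; [exact: clifford1 | move=> A _; rewrite mul1mx mulmx1]. Qed.

Lemma sym_cliffordM D E : G D -> G E -> G (D *m E).
Proof.
move=> [cD SD] [cE SE]; split; first exact: cliffordM.
by move=> A SA; rewrite -mulmxA SE // !mulmxA SD.
Qed.

Lemma sym_clifford_phase D E : phase_eq D E -> G E -> G D.
Proof.
move=> DE [cE SE]; split; first exact: clifford_phase DE cE.
by case: DE => c [_ ->] A SA; rewrite -scalemxAl -scalemxAr SE.
Qed.

Lemma sym_clifford_unitary D : G D -> D \is unitarymx.
Proof. by case=> -[]. Qed.

Lemma sym_clifford_finite : finite_set (mod_phase G).
Proof.
apply: sub_finite_set (clifford_finite C n) => _ [D [cD _] <-].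
by exists D.
Qed.

Lemma mod_phase_nonempty : mod_phase G !=set0.
Proof. by exists (phase_class 1%:M); exists 1%:M => //; exact: sym_clifford1. Qed.

Lemma phase_class_get (T : set 'Op[C]_n) D :
  phase_class D = T -> phase_eq (xget 0 T) D.
Proof.
move=> <-; have : phase_class D D by exact: phase_eq_refl.
exact: xgetI.
Qed.

Lemma mod_phase_get (K : set 'Op[C]_n) : mod_phase G K ->
  G (xget 0 K) /\ phase_class (xget 0 K) = K.
Proof.
move=> [D GD DK]; have KD := phase_class_get DK; split.
  exact: sym_clifford_phase GD.
by rewrite -[RHS]DK; apply: phase_eq_class.
Qed.

Definition conj_chan D P := chan (D^t* *m P *m D).

Lemma conj_chan_phase D E P : phase_eq D E -> conj_chan D P = conj_chan E P.
Proof.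
move=> DE; apply: chan_phase.
exact: phase_eqM (phase_eqM (phase_eq_adj DE) (phase_eq_refl _)) DE.
Qed.

Lemma twirl_chanE P :
  twirl S (chan P) = avg (mod_phase G) (fun K => conj_chan (xget 0 K) P).
Proof.
apply: eq_avg => [|K _]; first exact: sym_clifford_finite.
by apply/funext => rho; rewrite /conj_chan /chan /= !adjmxM !mulmxA.
Qed.

Lemma twirl_phase A B : phase_eq A B -> twirl S (chan A) = twirl S (chan B).
Proof. by move=> /chan_phase ->. Qed.

(** Conjugating D^* P D by a further group element K is conjugating P by D K, and left
    multiplication by D permutes the phase classes of the group. *)
Lemma twirl_conj D P : G D ->
  twirl S (chan (D^t* *m P *m D)) = twirl S (chan P).
Proof.
move=> GD; rewrite !twirl_chanE.
pose s (K : set 'Op[C]_n) := phase_class (D *m xget 0 K).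
rewrite -[RHS](avg_reindex (s := s)).
- apply: eq_avg => [|K _]; first exact: sym_clifford_finite.
  rewrite (conj_chan_phase _ (phase_class_get (erefl (s K)))).
  by rewrite /conj_chan adjmxM !mulmxA.
- exact: sym_clifford_finite.
- move=> K /mod_phase_get[GK _]; exists (D *m xget 0 K) => //.
  exact: sym_cliffordM.
- move=> K K' /mod_phase_get[_ KE] /mod_phase_get[_ KE'] /phase_class_inj.
  move=> /(phase_eqM (phase_eq_refl (D^t*))).
  rewrite !mulmxA unitary_mulVmx ?mul1mx; last exact: sym_clifford_unitary.
  by move=> /phase_eq_class; rewrite KE KE'.
Qed.

(* If the twirl is constant along a finite G-stable family of operators, then
   averaging it over the family and exchanging the two averages makes each
   element of G merely permute the family. *)
Lemma twirl_orbit (T : choiceType) (O : set T) (f : T -> 'Op[C]_n) P :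
  finite_set O -> O !=set0 ->
  (forall x y, O x -> O y -> phase_eq (f x) (f y) -> x = y) ->
  (forall D x, G D -> O x ->
    exists2 y, O y & phase_eq (D^t* *m f x *m D) (f y)) ->
  (forall x, O x -> twirl S (chan (f x)) = twirl S (chan P)) ->
  twirl S (chan P) = avg O (fun x => chan (f x)).
Proof.
move=> finO O0 finj stable const.
rewrite -[LHS](avg_const _ finO O0).
transitivity (avg O (fun x => twirl S (chan (f x)))).
  by apply: eq_avg => // x Ox; rewrite const.
transitivity (avg O (fun x =>
    avg (mod_phase G) (fun K => conj_chan (xget 0 K) (f x)))).
  by apply: eq_avg => // x _; rewrite twirl_chanE.
rewrite avg_exchange.
transitivity (avg (mod_phase G) (fun=> avg O (fun x => chan (f x)))); last first.
  by rewrite avg_const //; [exact: sym_clifford_finite | exact: mod_phase_nonempty].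
apply: eq_avg => [|K /mod_phase_get[GK _]]; first exact: sym_clifford_finite.
(* s is the action on indices of the representative of K; its values outside O are arbitrary. *)
have /choice[s sP] (x : T) : exists y, O x ->
    O y /\ phase_eq ((xget 0 K)^t* *m f x *m xget 0 K) (f y).
  have [Ox|nOx] := pselect (O x); last by exists x.
  by have [y] := stable _ _ GK Ox; exists y.
rewrite -[RHS](avg_reindex (s := s)) //.
- by apply: eq_avg => // x /sP[_ /chan_phase].
- by move=> x /sP[].
(* Equal images have phase-equal conjugates; undoing the conjugation makes f x and f y
   phase-equal. *)
- move=> x y Ox Oy sxy; apply: finj => //.
  have [_ fx] := sP x Ox; have [_ fy] := sP y Oy.
  have uK := sym_clifford_unitary GK.
  have unconj A : xget 0 K *m ((xget 0 K)^t* *m A *m xget 0 K) *m (xget 0 K)^t* = A.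
    by rewrite !mulmxA (unitarymxP uK) mul1mx -mulmxA (unitarymxP uK) mulmx1.
  rewrite -(unconj (f x)) -(unconj (f y)).
  apply: phase_eqM (phase_eq_refl _); apply: phase_eqM (phase_eq_refl _) _.
  by apply: phase_eq_trans fx _; rewrite sxy; apply: phase_eq_sym.
Qed.

(** * Transvections: Clifford square roots of Pauli operators up to phase *)

Section Transvection.
Variable V : 'Op[C]_n.
Hypothesis pV : paulis n V.

(* exp (i pi V / 4) *)
Definition transvection : 'Op[C]_n := (sqrtC 2)^-1 *: (1%:M + 'i *: V).

Lemma transvection_adj : transvection^t* = (sqrtC 2)^-1 *: (1%:M - 'i *: V).
Proof.
rewrite /transvection adjmxZ adjmxD adjmxZ adjmx1 paulis_adj // conjCi scaleNr.
by rewrite geC0_conj // invr_ge0 sqrtC_ge0 ler0n.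
Qed.

Lemma sqrt2V_sq : (sqrtC 2)^-1 * (sqrtC 2)^-1 = 2^-1 :> C.
Proof. by rewrite -invfM -expr2 sqrtCK. Qed.

Lemma transvection_mul_conj : (1%:M - 'i *: V) *m (1%:M + 'i *: V) = 2 *: 1%:M.
Proof.
rewrite mulmxDl mul1mx mulNmx mulmxDr mulmx1 -scalemxAl -scalemxAr paulis_sq //.
rewrite scalerA mulii scaleN1r opprD opprK addrA addrK.
by rewrite scaler_nat mulr2n.
Qed.

Lemma transvection_sq : (1%:M + 'i *: V) *m (1%:M + 'i *: V) = (2 * 'i) *: V.
Proof.
rewrite mulmxDl mul1mx mulmxDr mulmx1 -scalemxAl -scalemxAr paulis_sq //.
rewrite scalerA mulii scaleN1r.
rewrite ['i *: V + - _]addrC addrACA addrN add0r.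
by rewrite -scalerDl mulr_natl mulr2n.
Qed.

Lemma transvection_unitary : transvection \is unitarymx.
Proof.
apply/unitarymxP; apply: mulmx1C; rewrite transvection_adj.
rewrite -scalemxAl -scalemxAr scalerA sqrt2V_sq transvection_mul_conj.
by rewrite scalerA mulVf ?scale1r // pnatr_eq0.
Qed.

Lemma transvection_comm A : V *m A = A *m V -> transvection *m A = A *m transvection.
Proof.
move=> VA; rewrite -scalemxAl -scalemxAr mulmxDl mulmxDr mul1mx mulmx1.
by rewrite -scalemxAl -scalemxAr VA.
Qed.

(** Write T for the transvection. Anticommutation turns T^* A into A T, so the conjugate is A T T,
    and T T = i V. *)
Lemma transvection_anti A : V *m A = - (A *m V) ->
  transvection^t* *m A *m transvection = 'i *: (A *m V).
Proof.
move=> VA.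
have -> : transvection^t* *m A = A *m transvection.
  rewrite transvection_adj -scalemxAl -scalemxAr mulmxDl mulmxDr mul1mx mulmx1.
  by rewrite mulNmx -scalemxAl -scalemxAr VA scalerN opprK.
rewrite -mulmxA scalemxAr; congr (_ *m _); rewrite /transvection.
rewrite -scalemxAl -scalemxAr scalerA sqrt2V_sq transvection_sq.
by rewrite scalerA mulrA mulVf ?mul1r ?pnatr_eq0.
Qed.

Lemma transvection_clifford : clifford transvection.
Proof.
have uT := transvection_unitary.
(* The conjugation computed above is T^* P T, so the Clifford property is checked on the adjoint: P
   is fixed if it commutes with V and becomes P V up to phase otherwise. *)
rewrite -[transvection]adjmxK; apply: clifford_adj.
split=> [|P pP]; first by rewrite trmxC_unitary.
rewrite adjmxK; have [VP|VP] := paulis_comm pV pP.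
  exists P => //; rewrite -mulmxA -transvection_comm // mulmxA.
  by rewrite unitary_mulVmx // mul1mx; apply: phase_eq_refl.
have [Q pQ PVQ] := paulisM pP pV; exists Q => //.
rewrite transvection_anti //; apply: phase_eq_trans PVQ.
by apply: phase_eq_scale; exact: normCi.
Qed.
End Transvection.

(** The elementary move inside an orbit: the transvection along the Pauli representative of V lies
    in the group and sends X to X V up to phase. *)
Lemma twirl_transvection X V : ppauli V ->
  (forall A, S A -> V *m A = A *m V) -> X *m V = - (V *m X) ->
  twirl S (chan (X *m V)) = twirl S (chan X).
Proof.
move=> [Q pQ VQ] VS XV.
have [c [c1 QV]] := phase_eq_sym VQ.
have GQ : G (transvection Q).
  split=> [|A SA]; first exact: transvection_clifford.
  by apply: transvection_comm; rewrite QV -scalemxAl -scalemxAr VS.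
rewrite -(twirl_conj X GQ) transvection_anti //; last first.
  by rewrite QV -scalemxAl -scalemxAr XV scalerN opprK.
apply: twirl_phase; apply: phase_eq_trans (phase_eqM (phase_eq_refl X) VQ) _.
by apply: phase_eq_sym; apply: phase_eq_scale; exact: normCi.
Qed.

End Twirl.

(** * Twirling of a Pauli channel *)

Section SymmetricTwirl.
Variables (C : numClosedFieldType) (n n1 n2 n3 : nat).
Variables (hn : (n1 + n2 + n3)%N = n) (W : 'Op[C]_n) (S : set 'Op[C]_n).
Hypothesis cW : clifford W.

(** Coordinates adapted to the decomposition: conjugation by W brings the stabilizer to product
    form. *)
Definition wtens (A : 'Op[C]_n1) (B : 'Op[C]_n2) (E : 'Op[C]_n3) : 'Op[C]_n :=
  W^t* *m tens3 hn A B E *m W.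

Hypothesis hS : mod_phase S = mod_phase
  [set wtens A.1.1 A.1.2 A.2 | A in paulis n1 `*` IZ_strings n2 `*` I_strings n3].

Local Notation G := (sym_clifford S).
Implicit Types (D X Y : 'Op[C]_n).

Let uW : W \is unitarymx. Proof. by case: cW. Qed.

Lemma I_stringsE m (A : 'Op[C]_m) : I_strings m A <-> A = 1%:M.
Proof.
split=> [|->]; last exact: tens_power_1.
elim: m A => // m IH _ [_ -> [B /IH -> <-]]; exact: tensc1.
Qed.

Lemma wtensM A A' B B' E E' :
  wtens A B E *m wtens A' B' E' = wtens (A *m A') (B *m B') (E *m E').
Proof. by rewrite /wtens -conj_unitaryM // tens3M. Qed.

Lemma wtens_phase A A' B B' E E' : phase_eq A A' -> phase_eq B B' ->
  phase_eq E E' -> phase_eq (wtens A B E) (wtens A' B' E').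
Proof. by move=> *; apply/phase_eq_conj/tens3_phase. Qed.

Lemma wtensN1 A B E : wtens (- A) B E = - wtens A B E.
Proof. by rewrite /wtens tens3N1 mulmxN mulNmx. Qed.

Lemma wtensN2 A B E : wtens A (- B) E = - wtens A B E.
Proof. by rewrite /wtens tens3N2 mulmxN mulNmx. Qed.

Lemma wtensN3 A B E : wtens A B (- E) = - wtens A B E.
Proof. by rewrite /wtens tens3N3 mulmxN mulNmx. Qed.

Lemma wtensK A B E : W *m wtens A B E *m W^t* = tens3 hn A B E.
Proof.
by rewrite !mulmxA (unitarymxP uW) mul1mx -mulmxA (unitarymxP uW) mulmx1.
Qed.

Lemma ppauli_wtens A B E : ppauli A -> ppauli B -> ppauli E -> ppauli (wtens A B E).
Proof.
move=> pA pB pE; rewrite /wtens -[X in _ *m _ *m X]adjmxK.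
by apply: clifford_conj; [exact: clifford_adj | exact: ppauli_tens3].
Qed.

Lemma wtens_inj A A' B B' E E' : paulis n1 A -> paulis n1 A' ->
  paulis n2 B -> paulis n2 B' -> paulis n3 E -> paulis n3 E' ->
  phase_eq (wtens A B E) (wtens A' B' E') -> [/\ A = A', B = B' & E = E'].
Proof.
move=> pA pA' pB pB' pE pE' eqw; apply: (tens3_inj (hn := hn)) => //.
rewrite -!wtensK; apply: phase_eqM (phase_eq_refl _).
exact: phase_eqM (phase_eq_refl _) eqw.
Qed.

Lemma ppauli_wtensE X : ppauli X -> exists A B E,
  [/\ paulis n1 A, paulis n2 B, paulis n3 E & phase_eq X (wtens A B E)].
Proof.
move=> /(clifford_conj cW)[P /(paulis_tens3 hn)[A [B [E [pA pB pE ->]]]] XP].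
exists A, B, E; split=> //.
have -> : X = W^t* *m (W *m X *m W^t*) *m W.
  by rewrite !mulmxA unitary_mulVmx // mul1mx -mulmxA unitary_mulVmx // mulmx1.
exact: phase_eq_conj.
Qed.

(** S is known only up to phase, but rescaling an operator does not affect what commutes with it. *)
Lemma sym_clifford_comm D A B : G D -> paulis n1 A -> IZ_strings n2 B ->
  D *m wtens A B 1%:M = wtens A B 1%:M *m D.
Proof.
move=> [_ DS] pA zB.
have : mod_phase S (phase_class (wtens A B 1%:M)).
  by rewrite hS; exists (wtens A B 1%:M) => //; exists (A, B, 1%:M) => //;
    split=> //; apply/I_stringsE.
move=> [N SN /phase_class_inj/phase_eq_sym[c [_ ->]]].
by rewrite -scalemxAl -scalemxAr DS.
Qed.

(** The reverse transfer, from the representatives to S, by the same insensitivity to phase; it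
    certifies that transvections lie in the group. *)
Lemma comm_stabilizer V :
  (forall A B, paulis n1 A -> IZ_strings n2 B ->
    V *m wtens A B 1%:M = wtens A B 1%:M *m V) ->
  forall N, S N -> V *m N = N *m V.
Proof.
move=> comm N SN.
have : mod_phase S (phase_class N) by exists N.
rewrite hS => -[_ [[[A B] E] [[pA zB] /I_stringsE /= ->] <-]].
move=> /phase_class_inj/phase_eq_sym[c [_ ->]].
by rewrite -scalemxAl -scalemxAr comm.
Qed.

(* Commuting up to sign with N passes from X to D^* X D when D commutes with
   N, so the two signs cancel in X^* D^* X D. *)
Lemma commutator_comm D X N : D \is unitarymx -> X \is unitarymx ->
  D *m N = N *m D -> X *m N = N *m X \/ X *m N = - (N *m X) ->
  X^t* *m (D^t* *m X *m D) *m N = N *m (X^t* *m (D^t* *m X *m D)).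
Proof.
move=> uD uX DN XNs.
have DN' : D^t* *m N = N *m D^t*.
  rewrite -[LHS]mulmx1 -(unitarymxP uD) -mulmxA (mulmxA N) -DN !mulmxA.
  by rewrite unitary_mulVmx // mul1mx.
have [e [ee XN]] : exists e : C, e * e = 1 /\ X *m N = e *: (N *m X).
  by case: XNs => XN; [exists 1 | exists (- 1)];
    rewrite ?mulrNN mulr1 ?scaleN1r ?scale1r.
(* The same sign e governs moving N across X and across its adjoint. *)
have XN' : N *m X^t* = e *: (X^t* *m N).
  rewrite -[N in LHS]mul1mx -(unitary_mulVmx uX) -(mulmxA (X^t*)) XN.
  rewrite -scalemxAr -scalemxAl; congr (_ *: _).
  by rewrite -!mulmxA (unitarymxP uX) mulmx1.
rewrite -!mulmxA DN (mulmxA X) XN (mulmxA N) XN'.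
rewrite -!scalemxAl -!scalemxAr; congr (_ *: _).
by rewrite -!mulmxA (mulmxA (D^t*) N) DN' !mulmxA.
Qed.

(** Stability of the families. Y = X^* D^* X D is a Pauli operator up to phase commuting with the
    stabilizer: a nonidentity first factor, or a second factor outside the I/Z strings, would
    anticommute with a stabilizer element. Then D^* X D = X Y. *)
Lemma sym_clifford_conj_wtens D A B E : G D ->
  ppauli A -> ppauli B -> ppauli E ->
  exists z R, [/\ IZ_strings n2 z, paulis n3 R &
    phase_eq (D^t* *m wtens A B E *m D) (wtens A (B *m z) R)].
Proof.
move=> GD pA pB pE; pose X := wtens A B E.
have pX : ppauli X by apply: ppauli_wtens.
have uX := ppauli_unitary pX; have uD := sym_clifford_unitary GD.
pose Y := X^t* *m (D^t* *m X *m D).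
have pY : ppauli Y.
  apply: ppauliM; first exact: ppauli_adj.
  rewrite -[X in _ *m _ *m X]adjmxK.
  by apply: clifford_conj => //; apply: clifford_adj; case: GD.
have XYE : X *m Y = D^t* *m X *m D by rewrite mulmxA (unitarymxP uX) mul1mx.
have commY a b : paulis n1 a -> IZ_strings n2 b ->
    Y *m wtens a b 1%:M = wtens a b 1%:M *m Y.
  move=> pa zb; have DN := sym_clifford_comm GD pa zb.
  have pN : ppauli (wtens a b 1%:M).
    by apply: ppauli_wtens; apply: ppauliW => //; [exact: IZ_paulis | exact: paulis_1].
  exact: commutator_comm DN (ppauli_comm pX pN).
have [R1 [R2 [R3 [pR1 pR2 pR3 YR]]]] := ppauli_wtensE pY.
have contra a b : paulis n1 a -> IZ_strings n2 b ->
    wtens a b 1%:M *m wtens R1 R2 R3 = - (wtens R1 R2 R3 *m wtens a b 1%:M) ->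
    False.
  move=> pa zb anti; have comm := commY a b pa zb.
  apply: (@unitary_comm_anti _ _ (wtens a b 1%:M) Y) => //.
  - by apply: ppauli_unitary; apply: ppauli_wtens; apply: ppauliW => //;
      [exact: IZ_paulis | exact: paulis_1].
  - exact: ppauli_unitary.
  - by case: YR => c [_ ->]; rewrite -scalemxAl -scalemxAr -scalerN anti.
have R1E : R1 = 1%:M.
  apply: contrapT => /(paulis_neq1_anti pR1)[a pa anti].
  apply: (contra a 1%:M) => //; first exact: IZ_1.
  by rewrite !wtensM anti wtensN1 !mul1mx !mulmx1.
have zR2 : IZ_strings n2 R2.
  apply: contrapT => /(IZ_sep pR2)[b zb anti].
  apply: (contra 1%:M b) => //; first exact: paulis_1.
  by rewrite !wtensM anti wtensN2 !mul1mx !mulmx1.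
(* The third factor is unconstrained, so R is the Pauli representative of E R3. *)
have [R pR ER] := ppauliM pE (ppauliW pR3).
exists R2, R; split=> //; rewrite -XYE.
apply: phase_eq_trans (phase_eqM (phase_eq_refl X) YR) _.
rewrite R1E wtensM mulmx1; apply: wtens_phase => //; exact: phase_eq_refl.
Qed.

(** A transvection along I (x) z (x) v is admissible because I/Z strings commute with each other. *)
Lemma twirl_wtens_step A B E z v : ppauli A -> ppauli B -> ppauli E ->
  IZ_strings n2 z -> ppauli v ->
  wtens A B E *m wtens 1%:M z v = - (wtens 1%:M z v *m wtens A B E) ->
  twirl S (chan (wtens A (B *m z) (E *m v))) = twirl S (chan (wtens A B E)).
Proof.
move=> pA pB pE zz pv anti; rewrite -{1}[A]mulmx1 -wtensM.
apply: twirl_transvection => //.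
  by apply: ppauli_wtens => //; apply: ppauliW; [exact: paulis_1 | exact: IZ_paulis].
apply: comm_stabilizer => a b pa zb.
by rewrite !wtensM !mul1mx !mulmx1 (IZ_comm zz zb).
Qed.

(** The target is X V with V = I (x) B' (x) E E'. One move suffices if X and V anticommute;
    otherwise a detour along some z anticommuting with B makes two. *)
Lemma twirl_orbit1 A B E B' E' : paulis n1 A -> paulis n2 B -> paulis n3 E ->
  ~ IZ_strings n2 B -> IZ_strings n2 B' -> paulis n3 E' ->
  twirl S (chan (wtens A (B *m B') E')) = twirl S (chan (wtens A B E)).
Proof.
move=> pA pB pE nzB zB' pE'.
have [ppA ppB ppE] := And3 (ppauliW pA) (ppauliW pB) (ppauliW pE).
have pv : ppauli (E *m E') by apply: ppauliM; apply: ppauliW.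
have p1 : ppauli (1%:M : 'Op[C]_n3) by apply: ppauliW; exact: paulis_1.
pose V := wtens 1%:M B' (E *m E'); pose X := wtens A B E.
have -> : wtens A (B *m B') E' = wtens A (B *m B') (E *m (E *m E')).
  by rewrite mulmxA paulis_sq // mul1mx.
have pV : ppauli V by apply: ppauli_wtens => //; apply: ppauliW;
  [exact: paulis_1 | exact: IZ_paulis].
have pX : ppauli X by apply: ppauli_wtens.
have [XV|XV] := ppauli_comm pX pV; last exact: twirl_wtens_step.
(* X commutes with V: pass through X V' for some V' anticommuting with X but
   commuting with V. *)
have [z zz anti] := IZ_sep pB nzB.
have step1 := @twirl_wtens_step A B E z 1%:M ppA ppB ppE zz p1.
rewrite -step1; last by rewrite !wtensM anti wtensN2 opprK !mul1mx !mulmx1.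
rewrite mulmx1.
have -> : B *m B' = (B *m z) *m (z *m B').
  by rewrite mulmxA -(mulmxA B) (paulis_sq (IZ_paulis zz)) mulmx1.
have ppz := ppauliW (IZ_paulis zz).
apply: (twirl_wtens_step ppA (ppauliM ppB ppz) ppE (IZ_M zz zB') pv).
have split1 : wtens A (B *m z) E = X *m wtens 1%:M z 1%:M.
  by rewrite wtensM !mulmx1.
have split2 : wtens 1%:M (z *m B') (E *m E') = wtens 1%:M z 1%:M *m V.
  by rewrite wtensM !mul1mx.
(* X Z anticommutes with Z V: among X, Z and V, only the pair X, Z contributes a sign. *)
have zX : wtens 1%:M z 1%:M *m X = - (X *m wtens 1%:M z 1%:M).
  by rewrite !wtensM anti wtensN2 !mul1mx !mulmx1.
have zV : wtens 1%:M z 1%:M *m V = V *m wtens 1%:M z 1%:M.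
  by rewrite !wtensM (IZ_comm zz zB') !mul1mx !mulmx1.
rewrite split1 split2; move: (wtens 1%:M z 1%:M) zX zV => Z zX zV.
rewrite (mulmxA (Z *m V)) -(mulmxA Z V) -XV (mulmxA Z X) zX !mulNmx opprK.
by rewrite zV mulmxA.
Qed.

(** If a anticommutes with P but not Q, and b with Q but not P, then a b anticommutes with both. *)
Lemma common_anti (P Q : 'Op[C]_n3) : paulis n3 P -> paulis n3 Q ->
  P <> 1%:M -> Q <> 1%:M ->
  exists T, [/\ paulis n3 T, T *m P = - (P *m T) & T *m Q = - (Q *m T)].
Proof.
move=> pP pQ P1 Q1.
have [a pa aP] := paulis_neq1_anti pP P1; have [b pb bQ] := paulis_neq1_anti pQ Q1.
have [aQ|aQ] := paulis_comm pa pQ; last by exists a.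
have [bP|bP] := paulis_comm pb pP; last by exists b.
have [T pT /phase_eq_sym[c [_ TE]]] := paulisM pa pb.
exists T; split=> //; rewrite TE -scalemxAl -scalemxAr -scalerN; congr (_ *: _).
- by rewrite -mulmxA bP !mulmxA aP mulNmx.
- by rewrite -mulmxA bQ mulmxN !mulmxA aQ.
Qed.

(** Both members are joined through A (x) B' (x) T, where T anticommutes with E and E': one move
    along I (x) B B' (x) E T, the next along I (x) I (x) T E'. *)
Lemma twirl_orbit2 A B E B' E' : paulis n1 A -> IZ_strings n2 B ->
  paulis n3 E -> E <> 1%:M -> IZ_strings n2 B' -> paulis n3 E' -> E' <> 1%:M ->
  twirl S (chan (wtens A B' E')) = twirl S (chan (wtens A B E)).
Proof.
move=> pA zB pE E1 zB' pE' E'1.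
have [T [pT TE TE']] := common_anti pE pE' E1 E'1.
have ppA := ppauliW pA; have ppE := ppauliW pE; have ppT := ppauliW pT.
have ppB := ppauliW (IZ_paulis zB); have ppB' := ppauliW (IZ_paulis zB').
have -> : wtens A B' E' = wtens A (B' *m 1%:M) (T *m (T *m E')).
  by rewrite mulmx1 mulmxA paulis_sq // mul1mx.
rewrite (twirl_wtens_step ppA ppB' ppT (IZ_1 C n2) (ppauliM ppT (ppauliW pE'))).
  have -> : wtens A B' T = wtens A (B *m (B *m B')) (E *m (E *m T)).
    by rewrite !mulmxA !paulis_sq ?mul1mx //; exact: IZ_paulis.
  rewrite (twirl_wtens_step ppA ppB ppE (IZ_M zB zB') (ppauliM ppE ppT)) //.
  rewrite !wtensM !mul1mx !mulmx1 (IZ_comm zB (IZ_M zB zB')) -wtensN3.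
  by congr wtens; rewrite -mulmxA TE mulmxN opprK.
rewrite !wtensM !mul1mx !mulmx1 -wtensN3; congr wtens.
by rewrite -mulmxA -[E' *m T]opprK -TE' mulmxN opprK mulmxA.
Qed.

(** The first two cases apply [twirl_orbit] to families indexed by pairs of Pauli strings; in the
    third, P itself commutes with the group. *)
Theorem twirl_wtens P P1 P2 P3 : paulis n1 P1 -> paulis n2 P2 -> paulis n3 P3 ->
  phase_eq P (wtens P1 P2 P3) ->
  [/\ ~ IZ_strings n2 P2 -> twirl S (chan P) =
        avg (IZ_strings n2 `*` paulis n3)
          (fun Q => chan (wtens P1 (P2 *m Q.1) Q.2)),
      IZ_strings n2 P2 -> P3 <> 1%:M -> twirl S (chan P) =
        avg (IZ_strings n2 `*` (paulis n3 `\ 1%:M))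
          (fun Q => chan (wtens P1 Q.1 Q.2))
    & IZ_strings n2 P2 -> P3 = 1%:M -> twirl S (chan P) = chan P].
Proof.
move=> p1 p2 p3 PE; rewrite !(chan_phase PE).
have pp1 := ppauliW p1; have pp2 := ppauliW p2; have pp3 := ppauliW p3.
split.
- move=> nz2; apply: twirl_orbit.
  + by apply: finite_setX; [exact: IZ_finite | exact: paulis_finite].
  + by exists (1%:M, 1%:M); split; [exact: IZ_1 | exact: paulis_1].
  + move=> [z q] [z' q'] [/= zz pq] [/= zz' pq'].
    (* P2 z is a Pauli operator only up to phase, while [wtens_inj] compares genuine ones; this
       multiplication cancels P1 and P2, leaving I (x) z (x) q. *)
    move=> /(phase_eqM (phase_eq_refl (wtens P1 P2 1%:M))).
    rewrite !wtensM !mul1mx !mulmxA !paulis_sq // !mul1mx.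
    move=> /wtens_inj[]; rewrite ?paulis_sq //; try exact: paulis_1; try exact: IZ_paulis.
    by move=> _ -> ->.
  + move=> D [z q] GD [/= zz pq].
    have [z' [R [zz' pR conjE]]] : exists z' R, [/\ IZ_strings n2 z', paulis n3 R &
        phase_eq (D^t* *m wtens P1 (P2 *m z) q *m D) (wtens P1 (P2 *m z *m z') R)].
      apply: sym_clifford_conj_wtens => //; last exact: ppauliW.
      by apply: ppauliM => //; apply/ppauliW/IZ_paulis.
    exists (z *m z', R); first by split=> //; exact: IZ_M.
    by rewrite /= mulmxA.
  + by move=> [z q] [/= zz pq]; apply: twirl_orbit1.
- move=> z2 P31; apply: twirl_orbit.
  + apply: finite_setX; first exact: IZ_finite.
    by apply: sub_finite_set (paulis_finite C n3) => A [].
  + by exists (P2, P3).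
  + move=> [z q] [z' q'] [/= zz [pq _]] [/= zz' [pq' _]].
    by move=> /wtens_inj[] //; try exact: IZ_paulis; move=> _ -> ->.
  + move=> D [z q] GD [/= zz [pq q1]].
    have [z' [R [zz' pR conjE]]] : exists z' R, [/\ IZ_strings n2 z', paulis n3 R &
        phase_eq (D^t* *m wtens P1 z q *m D) (wtens P1 (z *m z') R)].
      by apply: sym_clifford_conj_wtens => //; apply: ppauliW => //; exact: IZ_paulis.
    have zzz' := IZ_M zz zz'.
    (* Were R the identity, the image would have stabilizer form and commute with D; undoing the
       conjugation would force q to be the identity. *)
    exists (z *m z', R) => //; split=> //; split=> //= R1; apply: q1 => /=.
    have uD := sym_clifford_unitary GD.
    have : phase_eq (D *m (D^t* *m wtens P1 z q *m D) *m D^t*)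
        (D *m wtens P1 (z *m z') R *m D^t*).
      exact: phase_eqM (phase_eqM (phase_eq_refl _) conjE) (phase_eq_refl _).
    rewrite R1 (sym_clifford_comm GD) // !mulmxA (unitarymxP uD) mul1mx.
    rewrite -!(mulmxA _ D) (unitarymxP uD) !mulmx1.
    by move=> /wtens_inj[] //; try exact: IZ_paulis; exact: paulis_1.
  + by move=> [z q] [/= zz [pq q1]]; apply: twirl_orbit2.
- move=> z2 P31; rewrite twirl_chanE.
  rewrite -[RHS](avg_const _ (sym_clifford_finite S) (mod_phase_nonempty S)).
  apply: eq_avg => [|K /mod_phase_get[GK _]]; first exact: sym_clifford_finite.
  have uK := sym_clifford_unitary GK.
  rewrite /conj_chan P31 -mulmxA -(sym_clifford_comm GK) //.
  by rewrite mulmxA unitary_mulVmx // mul1mx.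
Qed.
End SymmetricTwirl.

(** * Specialization to the group generated by the Pauli support of a unitary *)

Theorem theoremS1 (R : realType) (n n1 n2 n3 : nat)
    (hn : (n1 + n2 + n3)%N = n)
    (U : 'Op[R[i]]_n) (hU : U \is unitarymx)
    (W : 'Op[R[i]]_n) (hW : clifford W)
    (hQ : mod_phase (pauli_group_of U) =
          mod_phase [set W^t* *m tens3 hn A.1.1 A.1.2 A.2 *m W
                      | A in paulis n1 `*` IZ_strings n2 `*` I_strings n3])
    (P : 'Op[R[i]]_n) (hP : paulis n P)
    (P1 : 'Op[R[i]]_n1) (P2 : 'Op[R[i]]_n2) (P3 : 'Op[R[i]]_n3)
    (hP1 : paulis n1 P1) (hP2 : paulis n2 P2) (hP3 : paulis n3 P3)
    (hPW : phase_eq P (W^t* *m tens3 hn P1 P2 P3 *m W)) :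
  [/\ ~ IZ_strings n2 P2 ->
      twirl (pauli_group_of U) (chan P) =
      avg (IZ_strings n2 `*` paulis n3)
        (fun Q => chan (W^t* *m tens3 hn P1 (P2 *m Q.1) Q.2 *m W)),
      IZ_strings n2 P2 -> P3 <> 1%:M ->
      twirl (pauli_group_of U) (chan P) =
      avg (IZ_strings n2 `*` (paulis n3 `\ 1%:M))
        (fun Q => chan (W^t* *m tens3 hn P1 Q.1 Q.2 *m W))
    & IZ_strings n2 P2 -> P3 = 1%:M ->
      twirl (pauli_group_of U) (chan P) = chan P].
Proof. exact: twirl_wtens hPW. Qed.
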